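(* Let $G$ be a Polish topological group and let $\phi$ be an automorphism of $G$. Then $G$ has the $\phi$-twisted Rokhlin property if and only if $G$ has the $\phi$-twisted joint embedding property ($\phi$-TJEP).
   Context: A topological group is Polish if its underlying topological space is separable and completely metrizable. Automorphisms are automorphisms of the underlying abstract group. The $\phi$-twisted conjugacy class of $x\in G$ is $C_\phi(x)=\{gx\phi(g)^{-1} : g\in G\}$, and $G$ has the $\phi$-twisted Rokhlin property if some $\phi$-twisted conjugacy class is dense in $G$. $G$ has the $\phi$-twisted joint embedding property ($\phi$-TJEP) if for any two non-empty open subsets $U,V$ of $G$ there exists $g\in G$ such that $U\cap gV\phi(g)^{-1}\neq\emptyset$. *)

(* Defs.v *)
From HB Require Import structures.
From mathcomp Require Import all_boot all_order all_algebra.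
From mathcomp Require Import all_classical all_reals.
From mathcomp Require Import topology.

Set Implicit Arguments.
Unset Strict Implicit.
Unset Printing Implicit Defensive.

Import Order.TTheory GRing.Theory Num.Theory.

Local Open Scope classical_set_scope.
Local Open Scope ring_scope.

(* Multiplicative, not necessarily abelian, counterpart of the library's
   topologicalZmodType; no separation axiom is built in. *)
HB.structure Definition PreTopologicalGroup :=
  {G of Topological G & Group G}.

HB.mixin Record PreTopologicalGroup_isTopologicalGroup G
    & PreTopologicalGroup G := {
  mulg_continuous : continuous (fun x : G * G => (x.1 * x.2)%g) ;
  invg_continuous : continuous (fun x : G => (x^-1)%g)
}.

#[short(type="topologicalGroupType")]
HB.structure Definition TopologicalGroup :=
  {G of PreTopologicalGroup G & PreTopologicalGroup_isTopologicalGroup G}.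

Definition separable (T : topologicalType) : Prop :=
  exists2 A : set T, countable A & dense A.

Definition is_metric (R : realType) (T : Type) (d : T -> T -> R) : Prop :=
  [/\ forall x y, 0 <= d x y,
      forall x y, d x y = 0 <-> x = y,
      forall x y, d x y = d y x
    & forall x y z, d x z <= d x y + d y z].

Definition metric_induces_topology (R : realType) (T : topologicalType)
    (d : T -> T -> R) : Prop :=
  forall x : T,
    nbhs x = filter_from [set e : R | 0 < e] (fun e => [set y | d x y < e]).

Definition metric_cauchy (R : realType) (T : Type) (d : T -> T -> R)
    (u : nat -> T) : Prop :=
  forall e : R, 0 < e ->
    exists N : nat, forall m n, (N <= m)%N -> (N <= n)%N -> d (u m) (u n) < e.

(* Convergence in the last clause is in the topology of T, which by the second
   clause is the topology of d. *)
Definition completely_metrizable (R : realType) (T : topologicalType) : Prop :=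
  exists d : T -> T -> R,
    [/\ is_metric d,
        metric_induces_topology d
      & forall u : nat -> T, metric_cauchy d u ->
          exists l : T, u n @[n --> \oo] --> l].

Definition polish (R : realType) (T : topologicalType) : Prop :=
  separable T /\ completely_metrizable R T.

Definition twisted_conj (G : groupType) (phi : G -> G) (g x : G) : G :=
  (g * x * (phi g)^-1)%g.

Definition twisted_class (G : groupType) (phi : G -> G) (x : G) : set G :=
  [set twisted_conj phi g x | g in [set: G]].

Definition twisted_rokhlin (G : topologicalGroupType) (phi : G -> G) : Prop :=
  exists x : G, dense (twisted_class phi x).

Definition twisted_jep (G : topologicalGroupType) (phi : G -> G) : Prop :=
  forall U V : set G, open U -> U !=set0 -> open V -> V !=set0 ->
    exists g : G, U `&` [set twisted_conj phi g v | v in V] !=set0.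

(* Main.v *)
Require Import Defs.
From mathcomp Require Import all_boot all_classical all_reals topology.
From mathcomp Require Import all_order all_algebra lra.

(** Twisted conjugation x |-> g x phi(g)^-1 is an action of the group G on the
    space G: multiplicativity of phi makes it an action, and for fixed g it is
    a left translation followed by the right translation by the constant
    phi(g)^-1, hence continuous.  The statement is then an instance of the
    general fact that an action by homeomorphisms on a separable completely
    metrizable space has a dense orbit if and only if it is topologically
    transitive.

    A dense orbit meets both U and V, and the group element carrying the second
    orbit point to the first moves a point of V into U.

    Conversely, fix a countable family of non-empty open sets B n such that every
    non-empty open set contains one of them ([countable_pi_base]).  The union of
    all translates of B n is open, and transitivity says precisely that it is
    dense.  By the Baire category theorem ([baire]) some x lies in all these
    unions; the orbit of such an x meets every B n, hence every non-empty open
    set. *)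

Set Implicit Arguments.
Unset Strict Implicit.
Unset Printing Implicit Defensive.

Import Order.TTheory GRing.Theory Num.Theory.

Local Open Scope classical_set_scope.
Local Open Scope ring_scope.

(** * Metrizable spaces *)

Lemma exists_natSinv_lt (R : realType) (e : R) :
  0 < e -> exists n : nat, n.+1%:R^-1 < e.
Proof.
by move=> e0; have [n] := ltr_add_invr e0; rewrite add0r => ?; exists n.
Qed.

Section Metrizable.
Variables (R : realType) (T : topologicalType) (d : T -> T -> R).
Hypotheses (d_metric : is_metric d) (d_top : metric_induces_topology d).

Let mball x e : set T := [set y | d x y < e].

Let nbhs_mballP x (A : set T) :
  nbhs x A <-> exists2 e : R, 0 < e & mball x e `<=` A.
Proof. by rewrite d_top. Qed.

Let nbhs_mball x (e : R) : 0 < e -> nbhs x (mball x e).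
Proof. by move=> e0; apply/nbhs_mballP; exists e. Qed.

(** Interiors of balls of radius 1/(n+1) around a dense sequence.  Interiors
    save showing that balls are open, and they still contain the centre. *)
Lemma countable_pi_base : separable T -> [set: T] !=set0 ->
  exists B : nat -> set T,
    [/\ forall n, open (B n), forall n, B n !=set0
      & forall O : set T, open O -> O !=set0 -> exists n, B n `<=` O].
Proof.
case: d_metric => d_ge0 d_eq0 d_sym d_tri.
move=> [A cA dA] T0.
have [a aA] : exists a : nat -> T, A = range a.
  have [A0|/unsquash f] := pfcard_geP cA.
    by have [x [_]] := dA setT T0 openT; rewrite A0.
  by exists f; rewrite image_eq.
pose B (p : nat * nat) : set T := (mball (a p.1) p.2.+1%:R^-1)°.
exists (fun n => B (odflt (0%N, 0%N) (unpickle n))); split.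
- by move=> n; exact: open_interior.
- move=> n; set p := odflt _ _; exists (a p.1).
  by apply: nbhs_mball; rewrite invr_gt0.
- move=> O oO [x Ox].
  have /nbhs_mballP[e e0 eO] := open_nbhs_nbhs (conj oO Ox).
  have [n ne] : exists n : nat, n.+1%:R^-1 < e / 2.
    by apply: exists_natSinv_lt; lra.
  (* A centre closer to x than half of e has a ball of radius 1/(n+1) in O. *)
  have [y [xy]] : (mball x (e / 2))° `&` A !=set0.
    apply: dA; last exact: open_interior.
    by exists x; apply: nbhs_mball; lra.
  rewrite aA => -[i _ ai]; subst y; exists (pickle (i, n)).
  rewrite pickleK /= => z /interior_subset zi; apply: eO.
  move: xy zi => /interior_subset; rewrite /mball /=.
  move=> xi zi; have := lt_trans zi ne; have := d_tri x (a i) z; lra.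
Qed.

(** The Baire category theorem, by nested closed balls: the n-th step shrinks
    the current ball into W n, with a radius at most 1/(n+1) so that the centres
    form a Cauchy sequence. *)
Lemma baire :
  (forall u, metric_cauchy d u -> exists l : T, u n @[n --> \oo] --> l) ->
  forall W : nat -> set T, (forall n, open (W n)) -> (forall n, dense (W n)) ->
  dense (\bigcap_n W n).
Proof.
case: d_metric => d_ge0 d_eq0 d_sym d_tri cT W oW dW O [x0 Ox0] oO.
have /nbhs_mballP[e0 e0_gt0 e0O] := open_nbhs_nbhs (conj oO Ox0).
pose cball (p : T * R) : set T := [set z | d p.1 z <= p.2].
(* The hypothesis on the radius sits under the existential so that [choice]
   gives a total step function; it is discharged along the sequence p. *)
have shrink (q : nat * (T * R)) : exists p' : T * R, 0 < q.2.2 ->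
    [/\ 0 < p'.2, p'.2 <= q.1.+1%:R^-1, cball p' `<=` cball q.2
      & cball p' `<=` W q.1].
  case: q => n [x r] /=.
  have [r0|r0] := ltP 0 r; last by exists (x, r); rewrite ltNge r0.
  have [y [yb yW]] : (mball x r)° `&` W n !=set0.
    by apply: dW; [exists x; exact: nbhs_mball|exact: open_interior].
  have /nbhs_mballP[e e_gt0 eb] : nbhs y (mball x r `&` W n).
    by apply: filterI; [exact: yb|exact: open_nbhs_nbhs].
  (* Half of e, since the closed ball must fit into the open one. *)
  exists (y, Num.min (e / 2) n.+1%:R^-1) => _ /=.
  have le z : d y z <= Num.min (e / 2) n.+1%:R^-1 -> (mball x r `&` W n) z.
    by rewrite le_min => /andP[yz _]; apply: eb; rewrite /mball /=; lra.
  split=> [||z /le[/ltW]|z /le[]] //.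
    by rewrite lt_min divr_gt0 // invr_gt0 ltr0n.
  by rewrite ge_min lexx orbT.
have [f fP] := choice shrink.
pose p := fix p n := if n is m.+1 then f (m, p m) else (x0, e0 / 2).
have p_gt0 n : 0 < (p n).2.
  by elim: n => [|n IHn] /=; [lra|have [] := fP (n, p n) IHn].
have stepP n := fP (n, p n) (p_gt0 n).
have nested m n : (m <= n)%N -> cball (p n) `<=` cball (p m).
  elim: n => [|n IHn]; first by rewrite leqn0 => /eqP ->.
  rewrite leq_eqVlt => /predU1P[-> //|mn].
  by have [_ _ sub _] := stepP n; apply: subset_trans sub _; exact: IHn.
have centre m n : (m <= n)%N -> d (p m).1 (p n).1 <= (p m).2.
  move=> /nested; apply; rewrite /cball /=.
  by rewrite ((d_eq0 _ _).2 erefl) ltW.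
have [l pl] : exists l : T, (p n).1 @[n --> \oo] --> l.
  apply: cT => e e_gt0.
  have [n ne] : exists n : nat, n.+1%:R^-1 < e / 2.
    by apply: exists_natSinv_lt; lra.
  exists n.+1 => i j /centre ni /centre nj.
  have [_ /le_lt_trans/(_ ne) rn _ _] := stepP n.
  have := d_tri (p i).1 (p n.+1).1 (p j).1; rewrite (d_sym _ (p n.+1).1).
  move: ni nj rn => /=; lra.
have lball m : cball (p m) l.
  rewrite /cball /=; apply/ler_addgt0Pr => e e_gt0.
  have [n _ nl] := pl _ (nbhs_mball l e_gt0).
  have := nl (maxn m n) (leq_maxr _ _); rewrite /mball /= d_sym => le.
  have := centre m (maxn m n) (leq_maxl _ _).
  have := d_tri (p m).1 (p (maxn m n)).1 l; lra.
exists l; split; last first.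
  by move=> n _; have [_ _ _] := stepP n; apply; exact: (lball n.+1).
by apply: e0O; have := lball 0%N; rewrite /cball /mball /=; lra.
Qed.

End Metrizable.

(** * Twisted conjugation as a group action *)

Section TwistedConjugation.
Variables (G : topologicalGroupType) (phi : {multiplicative G -> G}).

Lemma twisted_conjM g h x :
  twisted_conj phi (g * h)%g x = twisted_conj phi g (twisted_conj phi h x).
Proof. by rewrite /twisted_conj gmulfM invgM !mulgA. Qed.

Lemma twisted_conj1 x : twisted_conj phi 1%g x = x.
Proof.
have phi1 : phi 1%g = 1%g.
  by apply: (mulgI (phi 1%g)); rewrite -gmulfM !mulg1.
by rewrite /twisted_conj phi1 invg1 mul1g mulg1.
Qed.

Lemma twisted_conjK g : cancel (twisted_conj phi g) (twisted_conj phi g^-1%g).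
Proof. by move=> x; rewrite -twisted_conjM mulVg twisted_conj1. Qed.

(** For fixed g this is x |-> g x c with the constant c = phi(g)^-1. *)
Lemma continuous_twisted_conj g : continuous (twisted_conj phi g).
Proof.
have mul_cvg (a b : G) : (z.1 * z.2)%g @[z --> (a, b)] --> (a * b)%g.
  exact: (mulg_continuous (a, b)).
move=> x; apply: (continuous2_cvg _ (mul_cvg _ _)); last exact: cvg_cst.
by apply: (continuous2_cvg _ (mul_cvg _ _)); [exact: cvg_cst|exact: cvg_id].
Qed.

Lemma rokhlin_jep : twisted_rokhlin phi -> twisted_jep phi.
Proof.
move=> [x dx] U V oU U0 oV V0.
have [_ [/[swap]-[g _ <-] Ug]] := dx U U0 oU.
have [_ [/[swap]-[h _ <-] Vh]] := dx V V0 oV.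
exists (g * h^-1)%g, (twisted_conj phi g x); split=> //.
by exists (twisted_conj phi h x) => //; rewrite -twisted_conjM mulgVK.
Qed.

(** The union of all translates of V, written with preimages because these are
    open by continuity; inverting g gives the same union. *)
Let saturation (V : set G) : set G :=
  \bigcup_g twisted_conj phi g @^-1` V.

Let open_saturation V : open V -> open (saturation V).
Proof.
move=> oV; apply: bigcup_open => g _.
by move/continuousP: (continuous_twisted_conj (g := g)); apply.
Qed.

Let dense_saturation V : twisted_jep phi -> open V -> V !=set0 ->
  dense (saturation V).
Proof.
move=> jep oV V0 U U0 oU.
have [g [_ [/[swap]-[v Vv <-] Uv]]] := jep U V oU U0 oV V0.
exists (twisted_conj phi g v); split=> //.
by exists g^-1%g => //=; rewrite twisted_conjK.
Qed.

Lemma jep_rokhlin (R : realType) : polish R G ->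
  twisted_jep phi -> twisted_rokhlin phi.
Proof.
move=> [sepG [d [d_metric d_top d_complete]]] jep.
have G0 : [set: G] !=set0 by exists 1%g.
have [B [oB B0 B_base]] := countable_pi_base d_metric d_top sepG G0.
have dB n := dense_saturation jep (oB n) (B0 n).
have [x [_ xB]] := baire d_metric d_top d_complete
  (fun n => open_saturation (oB n)) dB G0 openT.
exists x => O O0 oO.
have [n BO] := B_base O oO O0.
have [g _ Bgx] := xB n I.
by exists (twisted_conj phi g x); split; [exact: BO|exists g].
Qed.

End TwistedConjugation.

(* phi is an automorphism of the abstract group: no continuity is assumed. *)
Theorem proposition3p10 (R : realType) (G : topologicalGroupType)
    (phi : {multiplicative G -> G}) (phi_bij : bijective phi)
    (G_polish : polish R G) :
  twisted_rokhlin phi <-> twisted_jep phi.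
Proof.
split; [exact: rokhlin_jep|exact: (jep_rokhlin G_polish)].
Qed.
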